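(* Let $X$ be a finite-dimensional Banach space, $Y$ a Banach space, $F:X\rightrightarrows Y$ a closed multifunction, $A\subset X$ a closed set, $b\in Y$, $S:=\{x\in A:\ b\in F(x)\}$, and $a\in S$. Suppose that the generalized equation ''$b\in F(x)$ subject to $x\in A$'' is metrically subregular at $a$. Then there exist $\tau,\delta\in(0,+\infty)$ such that $$N(S,z)\cap B_{X^*}\subset\tau\big(D_c^*F(z,b)(B_{Y^*})+N_c(A,z)\cap B_{X^*}\big)\qquad\forall z\in S\cap B(a,\delta).$$
   Context: $B_{X^*},B_{Y^*}$ are the closed unit balls of the dual spaces; $B(a,\delta)$ is the open ball with center $a$ and radius $\delta$; $d(\cdot,C)$ is the distance to a set $C$ (with $d(\cdot,\emptyset)=+\infty$). A multifunction $F$ is closed if its graph $\mathrm{gph}(F)=\{(x,y): y\in F(x)\}$ is closed. The generalized equation is metrically subregular at $a\in S$ if there exists $\tau\in(0,+\infty)$ such that $d(x,S)\le\tau(d(b,F(x))+d(x,A))$ for all $x$ close to $a$. For a closed set $C$ in a Banach space and $a\in C$: the Clarke tangent cone $T_c(C,a)$ is the set of $v$ such that for all sequences $a_n\to a$ with $a_n\in C$ and $t_n\to0^+$ there exist $v_n\to v$ with $a_n+t_nv_n\in C$ for all $n$; the Clarke normal cone is $N_c(C,a)=\{x^*:\langle x^*,h\rangle\le0\ \forall h\in T_c(C,a)\}$. For $\varepsilon\ge0$, $\hat N_\varepsilon(C,x)=\{x^*:\limsup_{y\to x,\,y\in C}\frac{\langle x^*,y-x\rangle}{\|y-x\|}\le\varepsilon\}$.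 The Mordukhovich (limiting) normal cone $N(C,a)$ is the set of $x^*$ for which there exist sequences $\varepsilon_n\downarrow0$, $x_n\to a$ with $x_n\in C$, and $x_n^*\to x^*$ in the weak$^*$ topology with $x_n^*\in\hat N_{\varepsilon_n}(C,x_n)$ for all $n$. For $(x,y)\in\mathrm{gph}(F)$, the Clarke coderivative is $D_c^*F(x,y)(y^* )=\{x^*\in X^*:(x^*,-y^* )\in N_c(\mathrm{gph}(F),(x,y))\}$, and $D_c^*F(x,y)(V)=\bigcup_{y^*\in V}D_c^*F(x,y)(y^* )$. Sums of sets are Minkowski sums. *)

(* Defs.v *)
From HB Require Import structures.
From mathcomp Require Import all_boot all_order all_algebra.
From mathcomp Require Import all_classical all_reals all_analysis.

Set Implicit Arguments.
Unset Strict Implicit.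
Unset Printing Implicit Defensive.

Import Order.TTheory GRing.Theory Num.Theory.
Import numFieldNormedType.Exports.

Local Open Scope classical_set_scope.
Local Open Scope ring_scope.

Definition finite_dimensional (R : realType) (E : normedModType R) : Prop :=
  exists (n : nat) (e : 'I_n -> E),
    forall x : E, exists c : 'I_n -> R, x = \sum_(i < n) c i *: e i.

(* The topological dual is a set of functions, so sums and scalar multiples of
   functionals are those of the function space [E -> R]. *)
Definition dual (R : realType) (E : normedModType R) : set (E -> R) :=
  [set f | linear f /\ continuous f].

Definition dual_norm (R : realType) (E : normedModType R) (f : E -> R) :
    \bar R :=
  ereal_sup [set `|f x|%:E | x in [set x : E | `|x| <= 1]].

Definition dual_ball (R : realType) (E : normedModType R) : set (E -> R) :=
  [set f | dual f /\ (dual_norm f <= 1)%E].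
Arguments dual_ball {R} E.

(* The library's [edist_inf C x] (with value [+oo] when [C] is empty) is the
   infimum of the extended pseudometric [edist]; on normed modules it is the
   usual distance to a set. *)
Lemma edist_norm (R : realType) (E : normedModType R) (x y : E) :
  edist (x, y) = `|x - y|%:E.
Proof.
apply/eqP; rewrite eq_le; apply/andP; split.
  apply/lee_addgt0Pr => e e0; apply: ereal_inf_lbound.
  exists (`|x - y| + e); last by rewrite EFinD.
  by split => /=; [exact: ltr_wpDl | rewrite -ball_normE /= ltrDl].
apply: le_ereal_inf_tmp => u [r [r0 xyr] <-].
by move: xyr; rewrite /= -ball_normE /= lee_fin => /ltW.
Qed.

Lemma edist_infE (R : realType) (E : normedModType R) (C : set E) (x : E) :
  edist_inf C x = ereal_inf [set `|x - c|%:E | c in C].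
Proof.
by rewrite /edist_inf; congr ereal_inf; apply: eq_imagel => c _; rewrite edist_norm.
Qed.

Section normal_cones.
Variables (R : realType) (E : normedModType R).
Implicit Types (C : set E) (a x v : E) (f : E -> R) (eps : R).

Definition clarke_tangent C a : set E :=
  [set v | forall (a_ : nat -> E) (t_ : nat -> R),
     (forall n, C (a_ n)) -> a_ @ \oo --> a ->
     (forall n, 0 < t_ n) -> t_ @ \oo --> (0 : R) ->
     exists v_ : nat -> E,
       v_ @ \oo --> v /\ forall n, C (a_ n + t_ n *: v_ n)].

Definition clarke_normal C a : set (E -> R) :=
  [set f | dual f /\ forall h, clarke_tangent C a h -> f h <= 0].

(* The limsup is along the points of [C] tending to [x] and different from [x];
   it is [-oo] when [x] is isolated in [C]. *)
Definition eps_normal eps C x : set (E -> R) :=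
  [set f | dual f /\
     (limf_esup (fun y : E => (f (y - x) / `|y - x|)%:E) (within C x^')
        <= eps%:E)%E].

(* Weak-star convergence of a sequence is pointwise convergence. *)
Definition limiting_normal C a : set (E -> R) :=
  [set f | dual f /\
     exists (eps_ : nat -> R) (x_ : nat -> E) (f_ : nat -> E -> R),
       [/\ [/\ forall n, 0 <= eps_ n, nonincreasing_seq eps_ &
               eps_ @ \oo --> (0 : R)],
           (forall n, C (x_ n)) /\ x_ @ \oo --> a,
           forall v, (fun n => f_ n v) @ \oo --> f v &
           forall n, eps_normal (eps_ n) C (x_ n) (f_ n)]].

End normal_cones.

Section generalized_equations.
Variables (R : realType) (X Y : normedModType R).
Implicit Types (F : X -> set Y) (A : set X) (a x : X) (b y : Y).

Definition gph F : set (X * Y) := [set p | F p.1 p.2].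

Definition dual_pair (xs : X -> R) (ys : Y -> R) : X * Y -> R :=
  fun p => xs p.1 + ys p.2.

Definition clarke_coderivative F x y (ys : Y -> R) : set (X -> R) :=
  [set xs | dual xs /\ clarke_normal (gph F) (x, y) (dual_pair xs (- ys))].

Definition clarke_coderivative_image F x y (V : set (Y -> R)) :
    set (X -> R) :=
  \bigcup_(ys in V) clarke_coderivative F x y ys.

Definition solution_set F A b : set X := [set x | A x /\ F x b].

Definition metrically_subregular F A b a : Prop :=
  exists2 tau : R, 0 < tau &
    \forall x \near a,
      (edist_inf (solution_set F A b) x
         <= tau%:E * (edist_inf (F x) b + edist_inf A x))%E.

End generalized_equations.

(* Main.v *)
Require Import Defs.
From HB Require Import structures.
From mathcomp Require Import all_boot all_order all_algebra.
From mathcomp Require Import all_classical all_reals all_analysis.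
From mathcomp Require Import ring lra.

Set Implicit Arguments.
Unset Strict Implicit.
Unset Printing Implicit Defensive.

Import Order.TTheory GRing.Theory Num.Theory.
Import numFieldNormedType.Exports.

Local Open Scope classical_set_scope.
Local Open Scope ring_scope.

(** Why the theorem holds.

    Let [G] be the graph of [F] and [S] the solution set, and write [d_C] for
    the distance to a set [C].  The heart of the matter is that a limiting
    normal [f] to [S] at [z], of norm at most 1, satisfies the inequality
<<
      f h <= K |k| + K d_A°(z; h) + M d_G°((z,b); (h,k))      for all (h,k),
>>
    where [d_C°(a; _)] is the Clarke generalized directional derivative of the
    distance to [C], and the constant [K = 3 tau] involves only the modulus of
    subregularity.  It is obtained as follows.

    - If [f_n] is an [eps_n]-normal to [S] at [x_n] then [x_n] minimizes
      [x |-> eps' |x - x_n| - f_n (x - x_n)] locally on [S] for any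
      [eps' > eps_n].  Exact penalization ([exact_penalty]) removes this
      constraint at the price of a multiple of [d_S]; subregularity bounds
      [d_S x] by [tau (|y - b| + d_A x)] on [G]; a second exact
      penalization, now on [G], removes the constraint that [y] is in [F x].
      The result is [penalized_eps_normal].
    - Evaluate this along [(x_n, b) + t (h, k)], divide by [t] and let [n]
      tend to infinity ([limiting_normal_le]).  The Clarke derivative at the
      limit point takes into account all base points near it, so it absorbs
      the points [x_n], although Clarke normal cones themselves need not have
      a closed graph.
    - The constants do not depend on [f] because the [f_n] eventually have norm
      at most 2.  This is where finite dimension enters: pointwise convergence
      of linear forms is then convergence in norm ([pointwise_cvg_norm_le]).

    The right-hand side is a sum of three sublinear functionals of [(h, k)].  By
    the Hahn-Banach theorem, a linear form below such a sum splits into linear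
    forms below each summand ([linear_le_sublinearD]).  The one below [K |k|] is
    [K] times an element of the dual ball of [Y]; the one below [K d_A°] is [K]
    times an element of the dual ball of [X] that is a Clarke normal to [A]; the
    one below [M d_G°] is a Clarke normal to [G], because [d_G°] is nonpositive
    on the Clarke tangent cone ([clarke_derivative_tangent]).  Reading off
    the components gives the theorem ([normal_decomposition]). *)

(** * Linear forms *)

Section linear_forms.
Variables (R : realType) (E : lmodType R).
Implicit Types (f : E -> R) (x y : E).

Lemma linear_formD f x y : linear f -> f (x + y) = f x + f y.
Proof. by move=> /(_ 1 x y); rewrite !scale1r. Qed.

Lemma linear_form0 f : linear f -> f 0 = 0.
Proof. by move=> lf; have := linear_formD 0 0 lf; rewrite addr0; lra. Qed.

Lemma linear_formZ f a x : linear f -> f (a *: x) = a * f x.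
Proof. by move=> lf; have := lf a x 0; rewrite !addr0 linear_form0// addr0. Qed.

Lemma linear_formN f x : linear f -> f (- x) = - f x.
Proof. by move=> lf; rewrite -scaleN1r linear_formZ// mulN1r. Qed.

Lemma linear_formB f x y : linear f -> f (x - y) = f x - f y.
Proof. by move=> lf; rewrite linear_formD// linear_formN. Qed.

Lemma linear_form_sum f n (c : 'I_n -> R) (e : 'I_n -> E) :
  linear f -> f (\sum_(i < n) c i *: e i) = \sum_(i < n) c i * f (e i).
Proof.
move=> lf; elim/big_rec2 : _ => [|i y1 y2 _ <-]; first exact: linear_form0.
by rewrite linear_formD// linear_formZ.
Qed.

End linear_forms.

Section linear_forms_product.
Variables (R : realType) (X Y : lmodType R) (g : X * Y -> R).
Hypothesis lg : linear g.

Lemma linear_form_fst : linear (fun x => g (x, 0)).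
Proof.
move=> r x y; rewrite -lg; congr g; apply: injective_projections.
  by [].
exact: (esym (etrans (addr0 _) (scaler0 _ r))).
Qed.

Lemma linear_form_snd : linear (fun y => g (0, y)).
Proof.
move=> r x y; rewrite -lg; congr g; apply: injective_projections.
  exact: (esym (etrans (addr0 _) (scaler0 _ r))).
by [].
Qed.

Lemma linear_form_pair x y : g (x, y) = g (x, 0) + g (0, y).
Proof.
rewrite -linear_formD//; congr g; apply: injective_projections.
  exact: (esym (addr0 _)).
exact: (esym (add0r _)).
Qed.

End linear_forms_product.

Section dual_norm.
Variables (R : realType) (E : normedModType R).
Implicit Types (f : E -> R) (x y : E).

Lemma linear_form_abs_le f M :
  linear f -> (forall x, f x <= M * `|x|) -> forall x, `|f x| <= M * `|x|.
Proof.
move=> lf fM x; rewrite ler_norml fM andbT lerNl -linear_formN//.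
by rewrite -[leRHS](congr1 (fun r => M * r) (normrN x)).
Qed.

Lemma bounded_linear_dual f M :
  linear f -> (forall x, `|f x| <= M * `|x|) -> dual f.
Proof.
move=> lf fM; split => // x.
apply/cvgrPdist_lt => e e0; near=> y.
rewrite -linear_formB//; apply: le_lt_trans (fM _) _.
have M0 : 0 < `|M| + 1 by rewrite ltr_wpDl.
apply: (@le_lt_trans _ _ ((`|M| + 1) * `|x - y|)).
  by rewrite ler_wpM2r// (le_trans (ler_norm M))// lerDl.
rewrite -ltr_pdivlMl// mulrC.
near: y; apply: (@cvgr_dist_lt _ _ _ _ _ id) => //.
by rewrite divr_gt0.
Unshelve. all: by end_near. Qed.

Lemma dual_ball_le f : dual_ball E f -> forall x, `|f x| <= `|x|.
Proof.
move=> [[lf _] f1] x; have [->|x0] := eqVneq x 0.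
  by rewrite linear_form0// !normr0.
have nx0 : 0 < `|x| by rewrite normr_gt0.
have : (`|f (`|x|^-1 *: x)|%:E <= 1)%E.
  apply: le_trans f1; apply: ereal_sup_ubound; exists (`|x|^-1 *: x) => //=.
  by rewrite normrZ gtr0_norm ?invr_gt0// mulVf ?gt_eqF.
rewrite lee_fin linear_formZ// normrM gtr0_norm ?invr_gt0//.
by rewrite ler_pdivrMl// mulr1.
Qed.

Lemma le_dual_ball f :
  linear f -> (forall x, `|f x| <= `|x|) -> dual_ball E f.
Proof.
move=> lf fx; split.
  by apply: (@bounded_linear_dual _ 1) => // x; rewrite mul1r.
apply: ge_ereal_sup => _ [x /= x1 <-]; rewrite lee_fin.
exact: le_trans (fx x) x1.
Qed.

End dual_norm.

(** * Sublinear functionals and the Hahn-Banach theorem *)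

Section sublinear.
Variables (R : realType) (E : lmodType R).
Implicit Types (p q : E -> R) (f g : E -> R).

(** Positive homogeneity is required only as an inequality; equality is
    automatic ([sublinearZ]). *)
Definition sublinear p :=
  (forall x y, p (x + y) <= p x + p y) /\
  (forall t x, 0 <= t -> p (t *: x) <= t * p x).

Lemma sublinear0 p : sublinear p -> p 0 = 0.
Proof.
move=> [pD pZ]; have := pZ 0 0 (lexx _); rewrite scale0r mul0r => p0.
by have := pD 0 0; rewrite addr0; lra.
Qed.

Lemma sublinearZ p t x : sublinear p -> 0 <= t -> p (t *: x) = t * p x.
Proof.
move=> sp; rewrite le_eqVlt => /predU1P[<-|t0].
  by rewrite scale0r mul0r sublinear0.
apply/eqP; rewrite eq_le (sp.2 _ _ (ltW t0))/= -ler_pdivlMl//.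
have := sp.2 t^-1 (t *: x); rewrite scalerA mulVf ?gt_eqF// scale1r.
by apply; rewrite invr_ge0 ltW.
Qed.

Lemma sublinearD p q :
  sublinear p -> sublinear q -> sublinear (fun x => p x + q x).
Proof.
move=> [pD pZ] [qD qZ]; split=> [x y|t x t0].
  by have := pD x y; have := qD x y; lra.
by have := pZ t x t0; have := qZ t x t0; lra.
Qed.

Lemma sublinear_scale K p : 0 <= K -> sublinear p -> sublinear (fun x => K * p x).
Proof.
move=> K0 [pD pZ]; split=> [x y|t x t0].
  by rewrite -mulrDr ler_wpM2l.
by rewrite mulrCA ler_wpM2l// pZ.
Qed.

(** [K] is a convex cone in [E * R], thought of as an epigraph.  Apart from
    distances, every infimum below is an instance: the Clarke derivative, the infimum of a chain of
    sublinear functionals, the perturbation that proves minimal sublinear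
    functionals linear, and the infimal convolution behind
    [linear_le_sublinearD].  The vertical fibre at 0 controls all others from
    below, since the fibres at [x] and at [- x] add up to points of it. *)
Lemma lower_envelope_sublinear (K : E -> R -> Prop) :
  (forall x, exists c, K x c) ->
  (forall c, K 0 c -> 0 <= c) ->
  (forall x y c d, K x c -> K y d -> K (x + y) (c + d)) ->
  (forall t x c, 0 <= t -> K x c -> K (t *: x) (t * c)) ->
  sublinear (fun x => inf [set c | K x c]) /\
  (forall x c, K x c -> inf [set c | K x c] <= c).
Proof.
move=> Kne K0 KD KZ.
have Klb x : has_lbound [set c | K x c].
  have [d Kd] := Kne (- x); exists (- d) => c /= Kc.
  have := KD _ _ _ _ Kc Kd; rewrite subrr => /K0; lra.
have Kle x c : K x c -> inf [set c | K x c] <= c by move=> ?; apply: ge_inf.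
split=> //; split=> [x y|t x t0].
- rewrite -lerBlDr; apply: lb_le_inf; first exact: Kne.
  move=> c /= Kc; rewrite lerBlDr -lerBlDl.
  apply: lb_le_inf; first exact: Kne.
  by move=> d /= Kd; rewrite lerBlDl; apply/Kle/KD.
- move: t0; rewrite le_eqVlt => /predU1P[<-|t0].
    have [c Kc] := Kne x; rewrite mul0r; apply: Kle.
    by have := KZ 0 _ _ (lexx _) Kc; rewrite mul0r.
  rewrite -ler_pdivrMl//; apply: lb_le_inf; first exact: Kne.
  by move=> c /= Kc; rewrite ler_pdivrMl//; apply/Kle/KZ => //; exact: ltW.
Qed.

Definition sublinear_below p : Type :=
  {q : E -> R | sublinear q /\ forall x, q x <= p x}.

Definition SublinearBelow p q (sq : sublinear q) (qp : forall x, q x <= p x) :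
  sublinear_below p := exist _ q (conj sq qp).

(** Pushing [q] along [v] to [x |-> inf_(t >= 0) (q (x + t v) - t (q v))] gives
    a sublinear functional below [q], hence [q] itself by minimality; its
    competitor at [t = 1] is the missing inequality [q x + q v <= q (x + v)]. *)
Lemma minimal_sublinear_linear q :
  sublinear q ->
  (forall r, sublinear r -> (forall x, r x <= q x) -> forall x, r x = q x) ->
  linear q.
Proof.
move=> sq qmin; have [qD qZ] := sq.
have addq x v : q (x + v) = q x + q v.
  apply/eqP; rewrite eq_le qD /=.
  pose K y c := exists2 t, 0 <= t & q (y + t *: v) - t * q v <= c.
  have [] := @lower_envelope_sublinear K.
  - by move=> y; exists (q (y + 0 *: v) - 0 * q v), 0.
  - move=> c [t t0]; rewrite add0r; apply: le_trans.
    by rewrite sublinearZ// subrr.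
  - move=> y z c d [t t0 tc] [u u0 ud]; exists (t + u); first exact: addr_ge0.
    have := qD (y + t *: v) (z + u *: v).
    by rewrite addrACA -scalerDl mulrDl; lra.
  - move=> s y c s0 [t t0 tc]; exists (s * t); first exact: mulr_ge0.
    rewrite -scalerA -scalerDr sublinearZ// -mulrA -mulrBr.
    exact: ler_wpM2l.
  move=> sr rle; have rq y : inf [set c | K y c] <= q y.
    by apply: rle; exists 0 => //; rewrite scale0r addr0 mul0r subr0.
  rewrite -lerBrDr -(qmin _ sr rq); apply: rle; exists 1 => //.
  by rewrite scale1r mul1r.
have oppq x : q (- x) = - q x.
  by have := addq x (- x); rewrite subrr sublinear0//; lra.
move=> a x y; rewrite addq; congr (_ + _); rewrite /GRing.scale/=.
have [a0|a0] := leP 0 a; first exact: sublinearZ.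
have := @sublinearZ _ (- a) x sq; rewrite scaleNr oppq mulNr => H.
by apply: oppr_inj; apply: H; rewrite oppr_ge0 ltW.
Qed.

(** The Hahn-Banach theorem.  The pointwise infimum of a chain of sublinear
    functionals is sublinear, since any two members are comparable.  So Zorn's
    lemma gives a minimal sublinear functional below [p], which is linear. *)
Lemma hahn_banach p :
  sublinear p -> exists f : E -> R, linear f /\ forall x, f x <= p x.
Proof.
move=> sp; have pp x : p x <= p x by [].
(* Reversed order, so that a maximal element is a minimal functional. *)
pose R' (q r : sublinear_below p) := `[< forall x, sval r x <= sval q x >].
have [|||ch chtot|[q [sq qp]] qmax] := @Zorn (sublinear_below p) R'.
- by move=> q; apply/asboolP.
- move=> r q s /asboolP rq /asboolP qs; apply/asboolP => x.
  exact: le_trans (qs x) (rq x).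
- move=> [q Hq] [r Hr] /asboolP qr /asboolP rq; apply: eq_exist.
  by apply/funext => x; apply/eqP; rewrite eq_le (qr x) (rq x).
- have [[q0 chq0]|ch0] := pselect (ch !=set0); last first.
    exists (SublinearBelow sp pp) => s /= chs; exfalso; apply: ch0.
    by exists s.
  pose K x c := exists2 q : sublinear_below p, ch q & sval q x <= c.
  have [] := @lower_envelope_sublinear K.
  - by move=> y; exists (sval q0 y), q0.
  - by move=> c [[q [sq qp]] _ /=]; rewrite sublinear0.
  - move=> x y c d [q chq qc] [r chr rd].
    have [/asboolP qr|/asboolP rq] := chtot _ _ chq chr.
      exists r => //; apply: le_trans ((svalP r).1.1 _ _) _.
      by apply: lerD => //; apply: le_trans qc; apply: qr.
    exists q => //; apply: le_trans ((svalP q).1.1 _ _) _.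
    by apply: lerD => //; apply: le_trans rd; apply: rq.
  - move=> t x c t0 [q chq qc]; exists q => //.
    by apply: le_trans ((svalP q).1.2 _ _ t0) _; apply: ler_wpM2l.
  move=> sr rle.
  have rp x : inf [set c | K x c] <= p x.
    by apply: rle; exists q0 => //; exact: (svalP q0).2.
  exists (SublinearBelow sr rp) => s chs; apply/asboolP => x /=.
  by apply: rle; exists s.
exists q; split=> //; apply: minimal_sublinear_linear => // r sr rq x.
have rp y : r y <= p y by apply: le_trans (qp y).
have := qmax (SublinearBelow sr rp) _.
by move=> /(_ (asboolT rq))/(congr1 (fun u => sval u x)).
Qed.

(** A linear [g] is as required exactly when it lies below the sublinear
    functional [x |-> inf_w (p (x + w) + q w - f w)]: take [w = 0] for [g <= p]
    and [x = - w] for [f - g <= q]. *)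
Lemma linear_le_sublinearD f p q :
  linear f -> sublinear p -> sublinear q ->
  (forall x, f x <= p x + q x) ->
  exists g : E -> R, [/\ linear g, forall x, g x <= p x & forall x, f x - g x <= q x].
Proof.
move=> lf sp sq fpq.
pose K x c := exists w, p (x + w) + (q w - f w) <= c.
have [] := @lower_envelope_sublinear K.
- by move=> x; exists (p (x + 0) + (q 0 - f 0)), 0.
- by move=> c [w]; rewrite add0r; have := fpq w; lra.
- move=> x y c d [v vc] [w wd]; exists (v + w).
  have := sp.1 (x + v) (y + w); have := sq.1 v w.
  by rewrite addrACA (linear_formD _ _ lf); lra.
- move=> t x c t0 [w wc]; exists (t *: w).
  rewrite -scalerDr (linear_formZ _ _ lf) !sublinearZ// -mulrBr -mulrDr.
  exact: ler_wpM2l.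
move=> sr rle; have [g [lg gr]] := hahn_banach sr; exists g; split=> // x.
  apply: le_trans (gr x) _; apply: rle; exists 0.
  by rewrite addr0 sublinear0// (linear_form0 lf); lra.
have : g (- x) <= q x - f x.
  apply: le_trans (gr _) _; apply: rle; exists x.
  by rewrite addNr sublinear0// add0r.
by rewrite (linear_formN _ lg); lra.
Qed.

End sublinear.

(** * Distance functions and exact penalization *)

Section distance.
Variables (R : realType) (E : normedModType R).
Implicit Types (C : set E) (x y c : E).

(** Real-valued, with the value 0 rather than [+oo] when [C] is empty. *)
Definition dist C x : R := inf [set `|x - c| | c in C].

Lemma dist_le C x c : C c -> dist C x <= `|x - c|.
Proof.
move=> Cc; apply: ge_inf; last by exists c.
by exists 0 => _ [d _ <-].
Qed.

Lemma dist_mem C x : C x -> dist C x = 0.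
Proof.
move=> Cx; apply/eqP; rewrite eq_le; apply/andP; split.
  by have := dist_le x Cx; rewrite subrr normr0.
by apply: lb_le_inf => [|_ [c _ <-]//]; exists `|x - x|, x.
Qed.

Lemma dist_adherent C x e : C !=set0 -> 0 < e ->
  exists2 c, C c & `|x - c| < dist C x + e.
Proof.
move=> [c0 Cc0] e0; have [|_ [c Cc <-] ce] := @inf_adherent R [set `|x - c| | c in C] e e0.
  by split; [exists `|x - c0|, c0|exists 0 => _ [d _ <-]].
by exists c.
Qed.

Lemma dist_lip C x y : C !=set0 -> dist C x <= dist C y + `|x - y|.
Proof.
move=> C0; apply/ler_addgt0Pr => e e0; have [c Cc ce] := dist_adherent y C0 e0.
have := dist_le x Cc; have := ler_distD y x c; lra.
Qed.

Lemma edist_inf_dist C x : C !=set0 -> edist_inf C x = (dist C x)%:E.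
Proof.
move=> C0; rewrite edist_infE; apply/eqP; rewrite eq_le; apply/andP; split.
  apply/lee_addgt0Pr => e e0; have [c Cc ce] := dist_adherent x C0 e0.
  apply: (@le_trans _ _ `|x - c|%:E); first by apply: ereal_inf_lbound; exists c.
  by rewrite -EFinD lee_fin ltW.
by apply: le_ereal_inf_tmp => _ [c Cc <-]; rewrite lee_fin dist_le.
Qed.

(** Clarke's exact penalization: moving from [x] to an almost nearest point of
    [C] changes [g] by hardly more than [L * dist C x], and that point is still
    close to [s]. *)
Lemma exact_penalty C (g : E -> R) L s : 0 <= L -> C s ->
  (forall x y, g x <= g y + L * `|x - y|) ->
  (\forall x \near s, C x -> 0 <= g x) ->
  \forall x \near s, 0 <= g x + L * dist C x.
Proof.
move=> L0 Cs gL /nbhs_ballP[r /= r0 rg].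
(* For [x] within [r / 3] of [s], a point of [C] that is nearest up to [r / 3]
   lies within [r] of [s]. *)
have r3 : 0 < r / 3 by lra.
apply/nbhs_ballP; exists (r / 3) => //= x; rewrite -ball_normE/= distrC => xs.
apply/ler_addgt0Pr => e e0.
have d0 : 0 < Num.min (r / 3) (e / (L + 1)).
  by rewrite lt_min r3 divr_gt0// ltr_wpDl.
have [|c Cc] := @dist_adherent C x _ _ d0; first by exists s.
rewrite -ltrBlDl lt_min => /andP[c1 c2].
have := dist_le x Cs => dx.
have gc : 0 <= g c.
  apply: rg Cc; rewrite -ball_normE/=.
  by have := ler_distD x s c; rewrite (distrC s x); lra.
have := gL c x; rewrite (distrC c x).
have : L * (`|x - c| - dist C x) <= e.
  rewrite ltr_pdivlMr ?ltr_wpDl// in c2.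
  have [le0|/ltW ge0] := leP (`|x - c| - dist C x) 0.
    by apply: (@le_trans _ _ 0); [exact: mulr_ge0_le0|exact: ltW].
  by nra.
by rewrite mulrBr; lra.
Qed.

End distance.

(** * The Clarke derivative of the distance function *)

Lemma cvg_dist_le_harmonic (R : realType) (V : normedModType R)
    (u : nat -> V) (l : V) (M : R) :
  (forall n, `|l - u n| <= M * n.+1%:R^-1) -> u @ \oo --> l.
Proof.
move=> H; apply/cvgrPdist_lt => e e0.
have M0 : 0 < `|M| + 1 by rewrite ltr_wpDl.
have eM : 0 < e / (`|M| + 1) by rewrite divr_gt0.
near=> n; apply: le_lt_trans (H n) _.
have : n.+1%:R^-1 < e / (`|M| + 1).
  by near: n; exact: (near_infty_natSinv_lt (PosNum eM)).
rewrite ltr_pdivlMr//; apply: le_lt_trans.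
rewrite mulrC ler_wpM2l ?invr_ge0//.
by rewrite (le_trans (ler_norm M))// lerDl.
Unshelve. all: by end_near. Qed.

Section clarke_derivative.
Variables (R : realType) (E : normedModType R) (C : set E) (a : E).
Hypothesis Ca : C a.
Let C0 : C !=set0. Proof. by exists a. Qed.
Implicit Types (v w : E) (c : R).

(** The base point [x] is not restricted to [C]; this is what makes slopes
    additive ([clarke_slopeD]). *)
Definition clarke_slope v c := exists2 d, 0 < d &
  forall x t, ball a d x -> 0 < t < d -> dist C (x + t *: v) <= dist C x + t * c.

(** The generalized directional derivative at [a] in the direction [v], that is
    the upper limit of [(dist C (x + t v) - dist C x) / t] as [x] tends to [a]
    and [t] to [0+], written as the infimum of its eventual upper bounds. *)
Definition clarke_derivative v := inf [set c | clarke_slope v c].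

Lemma clarke_slope_norm v : clarke_slope v `|v|.
Proof.
exists 1 => // x t _ /andP[t0 _]; apply: le_trans (dist_lip _ x C0) _.
by rewrite addrAC subrr add0r normrZ gtr0_norm.
Qed.

Lemma clarke_slope0 c : clarke_slope 0 c -> 0 <= c.
Proof.
move=> [d d0 H]; have d2 : 0 < d / 2 by lra.
have := H a (d / 2) (ballxx _ d0); rewrite scaler0 addr0 lerDl pmulr_rge0//.
by apply; lra.
Qed.

Lemma clarke_slopeD v w c c' :
  clarke_slope v c -> clarke_slope w c' -> clarke_slope (v + w) (c + c').
Proof.
move=> [d d0 Hv] [d' d'0 Hw].
have M0 : 0 < `|v| + 1 by rewrite ltr_wpDl.
pose r := Num.min (d' / 2 / (`|v| + 1)) (Num.min d (d' / 2)).
have rP u : u < r -> [/\ u * (`|v| + 1) < d' / 2, u < d & u < d' / 2].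
  by rewrite !lt_min ltr_pdivlMr// => /and3P[].
exists r; first by rewrite !lt_min d0 !divr_gt0.
move=> x t; rewrite -ball_normE/= => /rP[_ xd xd'] /andP[t0 /rP[tv td td']].
have /= := Hv x t; rewrite -ball_normE/= xd t0 td => /(_ isT isT).
have /= := Hw (x + t *: v) t; rewrite -ball_normE/= t0 (_ : t < d')/=; last lra.
move=> /(_ _ isT); rewrite scalerDr addrA mulrDr.
have -> : `|a - (x + t *: v)| < d'.
  rewrite opprD addrA; apply: le_lt_trans (ler_normB _ _) _.
  by rewrite normrZ gtr0_norm//; lra.
by move=> /(_ isT); lra.
Qed.

Lemma clarke_slopeZ s v c :
  0 <= s -> clarke_slope v c -> clarke_slope (s *: v) (s * c).
Proof.
move=> s0 [d d0 H]; move: s0; rewrite le_eqVlt => /predU1P[<-|s0].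
  by exists 1 => // x t _ _; rewrite scale0r scaler0 mul0r mulr0 !addr0.
exists (Num.min d (d / s)); first by rewrite lt_min d0 divr_gt0.
move=> x t; rewrite -!ball_normE/= !lt_min => /andP[xd _].
rewrite ltr_pdivlMr// => /and3P[t0 td tsd].
by rewrite scalerA mulrA; apply: H; rewrite -?ball_normE//= mulr_gt0.
Qed.

Lemma clarke_derivative_sublinear : sublinear clarke_derivative.
Proof.
have [] := @lower_envelope_sublinear _ _ clarke_slope.
- by move=> v; exists `|v|; exact: clarke_slope_norm.
- exact: clarke_slope0.
- exact: clarke_slopeD.
- exact: clarke_slopeZ.
by [].
Qed.

Lemma clarke_derivative_le v c : clarke_slope v c -> clarke_derivative v <= c.
Proof.
have [] := @lower_envelope_sublinear _ _ clarke_slope.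
- by move=> w; exists `|w|; exact: clarke_slope_norm.
- exact: clarke_slope0.
- exact: clarke_slopeD.
- exact: clarke_slopeZ.
by move=> _; apply.
Qed.

Lemma clarke_derivative_norm v : clarke_derivative v <= `|v|.
Proof. exact/clarke_derivative_le/clarke_slope_norm. Qed.

Lemma le_clarke_derivative v K r s : 0 <= K ->
  (forall c, clarke_slope v c -> r <= s + K * c) ->
  r <= s + K * clarke_derivative v.
Proof.
move=> K0 H; move: K0; rewrite le_eqVlt => /predU1P[K0|K0].
  by have := H _ (clarke_slope_norm v); rewrite -K0 !mul0r.
rewrite -lerBlDl -ler_pdivrMl//; apply: lb_le_inf.
  by exists `|v|; exact: clarke_slope_norm.
by move=> c /= /H; rewrite ler_pdivrMl// lerBlDl.
Qed.

(** Otherwise some [x_n] tending to [a] and [t_n] tending to 0 have difference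
    quotients above some [e > 0].  Points [a_n] of [C], nearest to [x_n] up to
    [o(t_n)], tend to [a]; tangency provides [v_n] tending to [v] with
    [a_n + t_n v_n] in [C], which bounds [dist C (x_n + t_n v)] by
    [dist C x_n + o(t_n)]. *)
Lemma clarke_derivative_tangent v :
  clarke_tangent C a v -> clarke_derivative v <= 0.
Proof.
move=> Tv; apply/ler_addgt0Pr => e e0; rewrite add0r; apply: clarke_derivative_le.
apply: contrapT => nslope.
have H n : exists xt : E * R, [/\ ball a (n.+1%:R^-1) xt.1,
    0 < xt.2 < n.+1%:R^-1 &
    dist C xt.1 + xt.2 * e < dist C (xt.1 + xt.2 *: v)].
  apply: contrapT => nH; apply: nslope; exists n.+1%:R^-1.
    by rewrite invr_gt0.
  move=> x t xa t0; rewrite leNgt; apply/negP => xt; apply: nH.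
  by exists (x, t).
have [xt xtP] := choice H.
have H2 n : exists c : E, C c /\
    `|(xt n).1 - c| < dist C (xt n).1 + (xt n).2 * n.+1%:R^-1.
  have [|c Cc cx] := @dist_adherent _ _ C (xt n).1 ((xt n).2 * n.+1%:R^-1) C0.
    by have [_ /andP[t0 _] _] := xtP n; rewrite mulr_gt0.
  by exists c.
have [a_ a_P] := choice H2.
have a_a : a_ @ \oo --> a.
  apply: (@cvg_dist_le_harmonic _ _ _ _ 3) => n.
  have [] := xtP n; rewrite -ball_normE/= => xa /andP[t0 tn] _.
  have [_ ca] := a_P n.
  have := dist_le (xt n).1 Ca; have := ler_distD (xt n).1 a (a_ n).
  have n1 : n.+1%:R^-1 <= 1 :> R by rewrite invf_le1// ler1n.
  have : (xt n).2 * n.+1%:R^-1 <= n.+1%:R^-1.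
    by rewrite ger_pMl// ltW// (lt_le_trans tn).
  move: n1 xa ca; rewrite (distrC (xt n).1 a); set i := n.+1%:R^-1 => n1 xa ca.
  by lra.
have t_0 : (fun n => (xt n).2) @ \oo --> (0 : R).
  apply: (@cvg_dist_le_harmonic _ R^o _ _ 1) => n.
  have [_ /andP[t0 tn] _] := xtP n.
  by rewrite sub0r normrN gtr0_norm// mul1r ltW.
have [|v_ [v_v Cv]] := Tv a_ (fun n => (xt n).2) (fun n => (a_P n).1) a_a _ t_0.
  by move=> n; have [_ /andP[]] := xtP n.
have e2 : 0 < e / 2 by lra.
have [n [n1 n2]] : exists n, n.+1%:R^-1 < e / 2 /\ `|v - v_ n| < e / 2.
  near \oo => n; exists n; split; near: n.
    exact: (near_infty_natSinv_lt (PosNum e2)).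
  exact: cvgr_dist_lt.
have [_ /andP[t0 _]] := xtP n; have [_] := a_P n.
have := dist_le ((xt n).1 + (xt n).2 *: v) (Cv n).
rewrite opprD addrACA -scalerBr.
have := ler_normD ((xt n).1 - a_ n) ((xt n).2 *: (v - v_ n)).
rewrite normrZ (gtr0_norm t0).
move: n1; set i := n.+1%:R^-1 => n1.
have : (xt n).2 * (i + `|v - v_ n|) < (xt n).2 * e.
  by rewrite ltr_pM2l//; lra.
by rewrite mulrDr; lra.
Unshelve. all: by end_near. Qed.

Lemma clarke_derivative_normal (f : E -> R) M :
  0 <= M -> linear f ->
  (forall v, f v <= M * clarke_derivative v) -> clarke_normal C a f.
Proof.
move=> M0 lf fM; split.
  apply: (@bounded_linear_dual _ _ _ M) => //; apply: linear_form_abs_le => // v.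
  by apply: le_trans (fM v) _; rewrite ler_wpM2l// clarke_derivative_norm.
move=> v Tv; apply: le_trans (fM v) _.
by rewrite mulr_ge0_le0// clarke_derivative_tangent.
Qed.

End clarke_derivative.
(** * Linear forms on finite-dimensional spaces *)

Section finite_dimension.
Variables (R : realType) (X : completeNormedModType R).

(** A spanning family, free or not, gives coordinates bounded by the norm.  The
    images of the cubes [[-m, m]^n] are compact and cover [X], so by Baire's
    theorem one of them contains a ball; differences of its points then cover a
    ball centered at 0. *)
Lemma bounded_coordinates : finite_dimensional X ->
  exists (n : nat) (e : 'I_n -> X) (M : R), 0 <= M /\
    forall x, exists2 c : 'I_n -> R,
      x = \sum_(i < n) c i *: e i & forall i, `|c i| <= M * `|x|.
Proof.
move=> [n [e spane]]; exists n, e.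
pose phi (c : 'rV[R]_n) : X := \sum_(i < n) c ord0 i *: e i.
pose B (m : nat) : set 'rV[R]_n := 
    [set c | forall i, `[- m%:R, m%:R]%classic (c ord0 i)].
have phi_cont : continuous phi.
  apply: continuous_big; first exact: add_continuous.
  move=> i _ c; apply: cvgZr_tmp.
  exact: (nbhs_filter c).
  exact: coord_continuous.
have clB m : closed (phi @` B m).
  apply: compact_closed; first exact: norm_hausdorff.
  apply: continuous_compact; first exact: continuous_subspaceT.
  apply: (@rV_compact R n (fun=> `[- m%:R, m%:R]%classic)) => i.
  exact: segment_compact.
have [m [x0 [r r0 xr]]] : exists m x0, exists2 r : R, 0 < r & ball x0 r `<=` phi @` B m.
  apply: contrapT => H.
  have dB m : open (~` (phi @` B m)) /\ dense (~` (phi @` B m)).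
    split; first by rewrite openC.
    move=> O [y Oy] oO; apply: contrapT => OB; apply: H.
    have /nbhs_ballP[r /= r0 rO] := open_nbhs_nbhs (conj oO Oy).
    exists m, y, r => // z /rO Oz; apply: contrapT => Bz; apply: OB.
    by exists z.
  have [||x [_ Bx]] := @Baire R X _ dB setT; first by exists 0.
    exact: openT.
  have [c xE] := spane x.
  pose m := (\max_(i < n) (Num.truncn `|c i|).+1)%N.
  have := Bx m I; apply; exists (\row_i c i).
    move=> i /=; rewrite mxE in_itv/= -ler_norml.
    have := truncnS_gt `|c i|; move=> /ltW/le_trans; apply.
    by rewrite ler_nat (leq_bigmax i).
  by rewrite xE; apply: eq_bigr => i _; rewrite mxE.
exists (4 * m%:R / r); split; first by rewrite divr_ge0// ?mulr_ge0// ltW.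
move=> x; have [->|x_neq0] := eqVneq x 0.
  exists (fun=> 0); first by rewrite big1// => i _; rewrite scale0r.
  by move=> i; rewrite !normr0 mulr0.
have nx0 : 0 < `|x| by rewrite normr_gt0.
have [c0 B0 phi0] := xr _ (ballxx x0 r0).
have [|c Bc phic] := xr (x0 + (r / 2 / `|x|) *: x).
  rewrite -ball_normE/= opprD addrA subrr add0r normrN normrZ gtr0_norm ?divr_gt0//.
  by rewrite mulfVK ?gt_eqF//; lra.
exists (fun i => (2 * `|x| / r) * (c ord0 i - c0 ord0 i)).
  have : phi c - phi c0 = (r / 2 / `|x|) *: x by rewrite phic phi0 addrAC subrr add0r.
  move=> /(congr1 (fun y => (2 * `|x| / r) *: y)); rewrite scalerA.
  have -> : 2 * `|x| / r * (r / 2 / `|x|) = 1 by field; rewrite !gt_eqF.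
  rewrite scale1r.
  move=> xE; rewrite -[LHS]xE /phi -sumrB scaler_sumr; apply: eq_bigr => i _.
  by rewrite -scalerBl scalerA.
move=> i; rewrite normrM gtr0_norm ?divr_gt0 ?mulr_gt0//.
have : `|c ord0 i - c0 ord0 i| <= 2 * m%:R.
  apply: le_trans (ler_normB _ _) _.
  have := B0 i; have := Bc i; rewrite /= !in_itv/= -!ler_norml; lra.
move=> cc.
rewrite (_ : 4 * _ / r * _ = 2 * `|x| / r * (2 * m%:R)); last by field; rewrite gt_eqF.
by rewrite ler_wpM2l// ltW// divr_gt0// mulr_gt0.
Qed.

Lemma pointwise_cvg_norm_le (f_ : nat -> X -> R) (f : X -> R) e :
  finite_dimensional X -> 0 < e ->
  (forall n, linear (f_ n)) -> linear f ->
  (forall v, (fun n => f_ n v) @ \oo --> f v) ->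
  \forall n \near \oo, forall v, `|f_ n v - f v| <= e * `|v|.
Proof.
move=> /bounded_coordinates[k [b [M [M0 Mb]]]] e0 lf_ lf f_f.
have e1 : 0 < e / (k%:R * M + 1).
  by rewrite divr_gt0// ltr_wpDl// mulr_ge0.
have : \forall n \near \oo, forall i : 'I_k, `|f (b i) - f_ n (b i)| < e / (k%:R * M + 1).
  by apply: filter_forall => i; exact: cvgr_dist_lt.
apply: filterS => n fn v; have [c vE cM] := Mb v.
have -> : f_ n v - f v = \sum_(i < k) c i * (f_ n (b i) - f (b i)).
  rewrite [in LHS]vE (linear_form_sum _ _ (lf_ n)) (linear_form_sum _ _ lf).
  by rewrite -sumrB; apply: eq_bigr => i _; rewrite mulrBr.
apply: le_trans (ler_norm_sum _ _ _) _.
apply: (@le_trans _ _ (\sum_(i < k) M * `|v| * (e / (k%:R * M + 1)))).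
  apply: ler_sum => i _; rewrite normrM distrC.
  by apply: ler_pM => //; exact: ltW.
rewrite sumr_const card_ord -mulr_natl.
rewrite [leLHS](_ : _ = k%:R * M / (k%:R * M + 1) * (e * `|v|)); last first.
  by field; rewrite gt_eqF// ltr_wpDl// mulr_ge0.
rewrite -[leRHS]mul1r ler_wpM2r// ?mulr_ge0// ?(ltW e0)//.
by rewrite ler_pdivrMr ?ltr_wpDl ?mulr_ge0// mul1r lerDl.
Qed.

End finite_dimension.

(** * Normals to the solution set *)

Section generalized_equation.
Variables (R : realType).

Lemma eps_normal_near (E : normedModType R) (C : set E) x f (eps eps' : R) :
  eps_normal eps C x f -> eps < eps' ->
  \forall y \near x, C y -> f (y - x) <= eps' * `|y - x|.
Proof.
move=> [[lf _]]; rewrite limf_esupE => fe ee'.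
have /ereal_inf_lt[_ [V nV <-] Ve] : (ereal_inf [set ereal_sup
    [set (f (y - x) / `|y - x|)%:E | y in V] | V in within C x^'] < eps'%:E)%E.
  by apply: le_lt_trans fe _; rewrite lte_fin.
have : \forall y \near x, y != x -> C y -> V y by exact: nV.
apply: filterS => y Vy Cy.
have [->|yx] := eqVneq y x.
  by rewrite subrr linear_form0// normr0 mulr0.
have nyx : 0 < `|y - x| by rewrite normr_gt0 subr_eq0.
rewrite -ler_pdivrMr// -lee_fin; apply: le_trans (ltW Ve).
by apply: ereal_sup_ubound; exists y => //; exact: Vy.
Qed.

Lemma lipschitz_eps_linear (E : normedModType R) (f : E -> R) (L eps : R) s :
  linear f -> (forall v, `|f v| <= L * `|v|) -> 0 <= eps -> forall x y,
  eps * `|x - s| - f (x - s) <=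
  eps * `|y - s| - f (y - s) + (L + eps) * `|x - y|.
Proof.
move=> lf fL e0 x y.
have : f (y - s) - f (x - s) <= L * `|x - y|.
  rewrite -linear_formB// opprB addrA subrK distrC.
  exact: le_trans (ler_norm _) (fL _).
have : eps * `|x - s| <= eps * (`|x - y| + `|y - s|).
  by rewrite ler_wpM2l// ler_distD.
by rewrite mulrDr mulrDl; lra.
Qed.

Variables (X Y : normedModType R) (F : X -> set Y) (A : set X) (b : Y).
Let S := solution_set F A b.

(** [Lam] is a Lipschitz constant of [x |-> eps |x - s| - f (x - s)], kept apart
    from [L + eps] so that the final constants do not depend on [eps].  Once the
    multiple of [dist S] is replaced by [tau * Lam (|y - b| + dist A x)], the
    function to be penalized on the graph has Lipschitz constant
    [Lam + 2 tau Lam]. *)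
Lemma penalized_eps_normal (f : X -> R) s (tau L eps Lam : R) :
  linear f -> (forall v, `|f v| <= L * `|v|) ->
  0 <= eps -> 0 <= L -> L + eps <= Lam -> 0 <= tau -> S s ->
  (\forall y \near s, S y -> f (y - s) <= eps * `|y - s|) ->
  (\forall x \near s, edist_inf S x <=
     tau%:E * (edist_inf (F x) b + edist_inf A x))%E ->
  \forall p \near (s, b), f (p.1 - s) <=
    tau * Lam * (`|p.2 - b| + dist A p.1) + eps * `|p.1 - s| +
    (2 * (tau * Lam) + Lam) * dist (gph F) p.
Proof.
move=> lf fL e0 L0 LLam tau0 Ss fS subreg; have [As Fsb] := Ss.
have Lam0 : 0 <= Lam by apply: le_trans LLam; exact: addr_ge0.
pose g x := eps * `|x - s| - f (x - s).
have gL x y : g x <= g y + Lam * `|x - y|.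
  apply: le_trans (lipschitz_eps_linear s lf fL e0 x y) _.
  by rewrite lerD2l ler_wpM2r.
have gS : \forall x \near s, 0 <= g x + Lam * dist S x.
  apply: exact_penalty => //.
  by apply: filterS fS => x fx /fx; rewrite /g subr_ge0.
have K0 : 0 <= tau * Lam by exact: mulr_ge0.
pose Phi (p : X * Y) := g p.1 + tau * Lam * (`|p.2 - b| + dist A p.1).
have /nbhs_ballP[r /= r0 rP] : \forall x \near s, 0 <= g x + Lam * dist S x /\
    (edist_inf S x <= tau%:E * (edist_inf (F x) b + edist_inf A x))%E.
  exact: filterI gS subreg.
have : \forall p \near (s, b), 0 <= Phi p + (2 * (tau * Lam) + Lam) * dist (gph F) p.
  apply: exact_penalty => //.
  - by rewrite addr_ge0// mulr_ge0.
  - move=> p q; rewrite /Phi.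
    have [pq1 pq2] : `|p.1 - q.1| <= `|p - q| /\ `|p.2 - q.2| <= `|p - q|.
      by rewrite prod_normE !le_max !lexx orbT.
    have := gL p.1 q.1.
    have : Lam * `|p.1 - q.1| <= Lam * `|p - q| by rewrite ler_wpM2l.
    have : tau * Lam * (`|p.2 - b| + dist A p.1) <=
        tau * Lam * (`|p - q| + `|q.2 - b| + (dist A q.1 + `|p - q|)).
      rewrite ler_wpM2l//; have A0 : A !=set0 by exists s.
      have := dist_lip p.1 q.1 A0; have := ler_distD q.2 p.2 b; lra.
    by rewrite !mulrDr !mulrDl; lra.
  - apply/nbhs_ballP; exists r => //= p [/= sp _] Fp.
    have [gp] := rP _ sp; rewrite !edist_inf_dist; try by [exists s|exists p.2].
    rewrite -EFinD -EFinM lee_fin => dS.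
    rewrite /Phi; apply: le_trans gp _; rewrite lerD2l.
    rewrite (mulrC tau) -mulrA ler_wpM2l//.
    apply: le_trans dS _; rewrite ler_wpM2l// lerD2r distrC.
    exact: dist_le.
by apply: filterS => p; rewrite /Phi /g; lra.
Qed.

End generalized_equation.

(** The constant 3 bounds [2 + eps'], a Lipschitz constant of the functions
    penalized at the points [x_ n] for large [n], where [f_ n] has norm at most
    2 and [eps'] is at most 1. *)
Lemma limiting_normal_le (R : realType) (X : completeNormedModType R)
    (Y : normedModType R) (F : X -> set Y) (A : set X) (b : Y)
    (S := solution_set F A b) (f : X -> R) z tau :
  finite_dimensional X -> 0 <= tau -> S z ->
  (\forall x \near z, edist_inf S x <=
     tau%:E * (edist_inf (F x) b + edist_inf A x))%E ->
  limiting_normal S z f -> dual_ball X f ->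
  forall h k, f h <= tau * 3 * `|k| + tau * 3 * clarke_derivative A z h +
    (2 * (tau * 3) + 3) * clarke_derivative (gph F) (z, b) (h, k).
Proof.
move=> finX tau0 Sz subreg [[lf _]].
move=> [eps_ [x_ [f_ [[eps_ge0 _ eps_0] [Sx_ x_z] f_f fN]]]] f1 h k.
have [Az Fzb] := Sz.
have Gz : gph F (z, b) by [].
apply: (le_clarke_derivative Gz); first by lra.
move=> c' [d' d'0 slopeG].
rewrite addrAC; apply: (le_clarke_derivative Az); first by lra.
move=> c [d d0 slopeA].
apply/ler_addgt0Pr => e e0.
(* A bound strictly above [eps_ n], as [eps_normal_near] needs. *)
pose eps n := eps_ n + n.+1%:R^-1.
have eps0 : eps @ \oo --> (0 : R).
  by rewrite -(addr0 0); apply: cvgD => //; exact: cvg_harmonic.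
have lf_ n : linear (f_ n) by have [[]] := fN n.
have he0 : 0 < e / 2 / (`|h| + 1) by rewrite !divr_gt0// ltr_wpDl.
have e2 : 0 < e / 2 by rewrite divr_gt0.
have /nbhs_ballP[r /= r0 rS] := nbhs_interior subreg.
have [n [[n1 n2 n3] [n4 n5 n6] n7]] : exists n,
  [/\ [/\ (forall v, `|f_ n v - f v| <= 1 * `|v|), `|f h - f_ n h| < e / 2 &
      `|0 - eps n| < e / 2 / (`|h| + 1) ],
      [/\ `|0 - eps n| < 1, `|z - x_ n| < d & `|z - x_ n| < d'] &
      `|z - x_ n| < r ].
  near \oo => n; exists n; do !split.
  - by near: n; exact: pointwise_cvg_norm_le.
  - by near: n; apply: cvgr_dist_lt.
  - by near: n; apply: cvgr_dist_lt.
  - by near: n; apply: cvgr_dist_lt.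
  - by near: n; apply: cvgr_dist_lt.
  - by near: n; apply: cvgr_dist_lt.
  - by near: n; apply: cvgr_dist_lt.
have epsn0 : 0 < eps n by rewrite ltr_wpDl// invr_gt0.
move: n3 n4; rewrite sub0r normrN (gtr0_norm epsn0) ltr_pdivlMr ?ltr_wpDl// => n3 n4.
have f_n2 v : `|f_ n v| <= 2 * `|v|.
  have := n1 v; have := dual_ball_le f1 v.
  by have := ler_normD (f_ n v - f v) (f v); rewrite subrK; lra.
have near_x : \forall y \near x_ n, S y -> f_ n (y - x_ n) <= eps n * `|y - x_ n|.
  by apply: (eps_normal_near (fN n)); rewrite ltrDl invr_gt0.
have sub_x : (\forall x \near x_ n, edist_inf S x <=
     tau%:E * (edist_inf (F x) b + edist_inf A x))%E.
  by apply: rS; rewrite -ball_normE.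
have Le : 2 + eps n <= 3 by lra.
have := penalized_eps_normal (lf_ n) f_n2 (ltW epsn0) (ler0n _ _) Le tau0 (Sx_ n) near_x sub_x.
move=> /nbhs_ballP[rho /= rho0 rhoP].
have [t [t0 td td' trho]] : exists t, [/\ 0 < t, t < d, t < d' & t * (`|h| + `|k| + 1) < rho].
  pose u := Num.min d (Num.min d' (rho / (`|h| + `|k| + 1))).
  have M0 : 0 < `|h| + `|k| + 1 by rewrite ltr_wpDl// addr_ge0.
  have u0 : 0 < u by rewrite !lt_min d0 d'0 divr_gt0.
  exists (u / 2); rewrite -(ltr_pdivlMr _ _ M0).
  have : u / 2 < u by lra.
  rewrite {2}/u !lt_min => /and3P[ud ud' ur].
  by split=> //; rewrite divr_gt0.
have := rhoP (x_ n + t *: h, b + t *: k).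
rewrite /= !(addrAC _ _ (- _)) !subrr !add0r.
have hk : ball (x_ n, b) rho (x_ n + t *: h, b + t *: k).
  split; rewrite -ball_normE/= opprD addrA subrr add0r normrN normrZ gtr0_norm//.
    by apply: le_lt_trans trho; rewrite ler_pM2l// -addrA lerDl addr_ge0.
  by apply: le_lt_trans trho; rewrite ler_pM2l// addrAC addrC lerDl addr_ge0.
move=> /(_ hk){hk}; rewrite !normrZ gtr0_norm// linear_formZ//.
have [Ax Fx] := Sx_ n.
have := slopeA (x_ n) t; rewrite -ball_normE/= n5 t0 td => /(_ isT isT).
have zb : ball (z, b) d' (x_ n, b).
  by split; [rewrite -ball_normE|exact: ballxx].
have tdd' : 0 < t < d' by rewrite t0.
have /= := slopeG _ _ zb tdd'.
rewrite (dist_mem Ax) (@dist_mem _ _ (gph F) (x_ n, b))// !add0r => dG dA fth.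
have : f_ n h <= tau * 3 * (`|k| + c) + eps n * `|h| + (2 * (tau * 3) + 3) * c'.
  rewrite -(ler_pM2l t0); apply: le_trans fth _.
  have : tau * 3 * dist A (x_ n + t *: h) <= tau * 3 * (t * c).
    by rewrite ler_wpM2l//; lra.
  have : (2 * (tau * 3) + 3) * dist (gph F) (x_ n + t *: h, b + t *: k) <=
    (2 * (tau * 3) + 3) * (t * c') by rewrite ler_wpM2l//; lra.
  by rewrite !mulrDr; lra.
have := ler_norm (f h - f_ n h).
have : eps n * `|h| < e / 2.
  by apply: le_lt_trans n3; rewrite ler_pM2l// lerDl.
by rewrite !mulrDr; lra.
Unshelve. all: by end_near. Qed.

(** * Splitting the inequality into normals *)

(** [K] scales both balls, while [M], attached to the graph, is free: the Clarke
    normal cone of the graph absorbs it. *)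
Lemma normal_decomposition (R : realType) (X Y : normedModType R)
    (F : X -> set Y) (A : set X) (b : Y) z (f : X -> R) K M :
  solution_set F A b z -> 0 < K -> 0 <= M -> linear f ->
  (forall h k, f h <= K * `|k| + K * clarke_derivative A z h +
     M * clarke_derivative (gph F) (z, b) (h, k)) ->
  [set K *: f' | f' in
     [set u + v | u in clarke_coderivative_image F z b (dual_ball Y)
                & v in clarke_normal A z `&` dual_ball X]] f.
Proof.
move=> [Az Fzb] K0 M0 lf fle; have K0' := ltW K0.
have Gz : gph F (z, b) by [].
have dA := clarke_derivative_sublinear Az.
have dG := clarke_derivative_sublinear Gz.
pose pY (p : X * Y) := K * `|p.2|.
pose pA (p : X * Y) := K * clarke_derivative A z p.1.
pose pG (p : X * Y) := M * clarke_derivative (gph F) (z, b) p.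
have spY : sublinear pY.
  apply: sublinear_scale => //; split=> [p q|t p t0]; first exact: ler_normD.
  by rewrite normrZ ger0_norm.
have spA : sublinear pA.
  apply: sublinear_scale => //; split=> [p q|t p t0]; first exact: dA.1.
  exact: dA.2.
have spG : sublinear pG by exact: sublinear_scale.
have lf1 : linear (fun p : X * Y => f p.1) by move=> r p q; rewrite /= lf.
have [|g1 [lg1 g1Y g1AG]] := linear_le_sublinearD lf1 spY (sublinearD spA spG).
  by move=> [h k]; rewrite addrA; exact: fle.
have lf2 : linear (fun p : X * Y => f p.1 - g1 p).
  by move=> r p q; rewrite /= lf lg1 scalerBr opprD addrACA.
have [|g2 [lg2 g2A g2G]] := linear_le_sublinearD lf2 spA spG => //.
have g1_fst h : g1 (h, 0) = 0.
  have lg := linear_form_fst lg1.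
  have := g1Y (h, 0); have := g1Y (- h, 0); rewrite /pY/= normr0 mulr0.
  by rewrite (linear_formN _ lg); lra.
have g2_snd k : g2 (0, k) = 0.
  have lg := linear_form_snd lg2.
  have := g2A (0, k); have := g2A (0, - k); rewrite /pA/= sublinear0// mulr0.
  by rewrite (linear_formN _ lg); lra.
(* [g1] depends on [k] alone and [g2] on [h] alone, their bounds being constant
   in the other variable. *)
pose ys (k : Y) := K^-1 * g1 (0, k).
pose v (h : X) := K^-1 * g2 (h, 0).
pose u (h : X) := K^-1 * f h - v h.
have Kinv0 : 0 < K^-1 by rewrite invr_gt0.
have lys : linear ys.
  move=> r k l; rewrite /ys (linear_form_snd lg1 r k l).
  by rewrite /GRing.scale/=; ring.
have lv : linear v.
  move=> r k l; rewrite /v (linear_form_fst lg2 r k l).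
  by rewrite /GRing.scale/=; ring.
have lu : linear u.
  move=> r k l; rewrite /u lf lv.
  by rewrite /GRing.scale/=; ring.
have ys1 k : `|ys k| <= `|k|.
  rewrite -[leRHS]mul1r; apply: linear_form_abs_le => // {}k.
  by rewrite mul1r /ys ler_pdivrMl//; exact: g1Y.
have vA h : v h <= 1 * clarke_derivative A z h.
  by rewrite mul1r /v ler_pdivrMl//; exact: g2A.
have v1 h : `|v h| <= `|h|.
  rewrite -[leRHS]mul1r; apply: linear_form_abs_le => // {}h.
  by apply: le_trans (vA h) _; rewrite !mul1r clarke_derivative_norm.
have dys : dual_ball Y ys by exact: le_dual_ball.
have NA : clarke_normal A z v by apply: (clarke_derivative_normal Az (M := 1)).
have uys h k : u h + (- ys) k = K^-1 * (f h - g1 (h, k) - g2 (h, k)).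
  rewrite (linear_form_pair lg1 h k) (linear_form_pair lg2 h k) g1_fst g2_snd.
  by rewrite /u /ys /v fctE; ring.
have luys : linear (dual_pair u (- ys)).
  move=> r p q; rewrite /dual_pair.
  have -> : (r *: p + q).1 = r *: p.1 + q.1 by [].
  have -> : (r *: p + q).2 = r *: p.2 + q.2 by [].
  by rewrite lu !fctE lys /GRing.scale/=; ring.
have NG : clarke_normal (gph F) (z, b) (dual_pair u (- ys)).
  apply: (clarke_derivative_normal Gz (M := K^-1 * M)) => //.
    by rewrite mulr_ge0// ltW.
  move=> [h k]; rewrite /dual_pair/= uys -mulrA ler_pM2l//.
  exact: (g2G (h, k)).
have fX h : f h <= (K + M) * `|h|.
  apply: le_trans (fle h 0) _; rewrite normr0 mulr0 add0r mulrDl.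
  apply: lerD; rewrite ler_wpM2l//; first exact: clarke_derivative_norm.
  apply: le_trans (clarke_derivative_norm Gz _) _.
  by rewrite prod_normE /= normr0 ge_max lexx normr_ge0.
have du : dual u.
  apply: (@bounded_linear_dual _ _ _ (K^-1 * (K + M) + 1)) => //.
  apply: linear_form_abs_le => // h; rewrite mulrDl mul1r -mulrA /u.
  apply: lerD; first by rewrite ler_pM2l.
  by apply: le_trans (v1 h); rewrite -normrN ler_norm.
exists (u + v); last first.
  apply/funext => h; rewrite !fctE /u subrK /GRing.scale/=.
  by rewrite mulrA mulfV ?gt_eqF// mul1r.
exists u; first by exists ys.
by exists v => //; split=> //; exact: le_dual_ball.
Qed.

Unset Implicit Arguments.

Theorem theorem4p1 (R : realType) (X Y : completeNormedModType R)
    (F : X -> set Y) (A : set X) (b : Y) (a : X) :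
  finite_dimensional X ->
  closed (gph F) ->
  closed A ->
  solution_set F A b a ->
  metrically_subregular F A b a ->
  exists tau delta : R,
    [/\ 0 < tau, 0 < delta &
      forall z : X, (solution_set F A b `&` ball a delta) z ->
        limiting_normal (solution_set F A b) z `&` dual_ball X `<=`
        [set tau *: f | f in
          [set u + v | u in clarke_coderivative_image F z b (dual_ball Y)
                     & v in clarke_normal A z `&` dual_ball X]]].
Proof.
move=> finX _ _ _ [tau tau0 /nbhs_interior/nbhs_ballP[delta /= delta0 subreg]].
exists (tau * 3), delta; split => //; first by rewrite mulr_gt0.
move=> z [Sz az] f [Nf f1].
have [[lf cf] _] := f1.
have tau3 : 0 <= tau * 3 by lra.
apply: (normal_decomposition (M := 2 * (tau * 3) + 3)) => //.
- by rewrite mulr_gt0.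
- by lra.
by apply: limiting_normal_le => //; [exact: ltW|exact: subreg].
Qed.
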